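(* Let $\mathcal{B}$ be a design over $\mathbb{F}_2$ with parameters $2$-$(v,k,\lambda_2)$, let $G\le GL_v(2)$ be an automorphism group of $\mathcal{B}$, and let $\Psi=\Psi_1\sqcup\cdots\sqcup\Psi_m$, $\mathcal{B}=\mathcal{B}_1\sqcup\cdots\sqcup\mathcal{B}_n$ be the tactical decomposition given by the $G$-orbits on points and on blocks. Fix $l,r,s\in\{1,\dots,m\}$, a point $P\in\Psi_l$ and a point $R\in\Psi_r$. For $i=1,2,3$ let $\Psi_s^i(R)=\{Q\in\Psi_s:\dim\langle P,R,Q\rangle=i\}$, and let $\mathcal{S}_{rs}(P)=\{R'\in\Psi_r\setminus\{P\}: P+R'\in\Psi_s\}$. Then $|\Psi_s^1(R)|=1$ if $l=r=s$ and $R=P$, and $|\Psi_s^1(R)|=0$ otherwise. Furthermore: (1) If $l\ne r$, $r\ne s$, $s\ne l$: $|\Psi_s^2(R)|=1$ if $R\in\mathcal{S}_{rs}(P)$ and $0$ otherwise; $|\Psi_s^3(R)|=|\Psi_s|-1$ if $R\in\mathcal{S}_{rs}(P)$ and $|\Psi_s|$ otherwise. (2) If $l=r=s$: $|\Psi_s^2(R)|=3$ if $R\in\mathcal{S}_{rs}(P)$, $|\Psi_s|-1$ if $R=P$, and $2$ otherwise; $|\Psi_s^3(R)|=|\Psi_s|-3$ if $R\in\mathcal{S}_{rs}(P)$, $0$ if $R=P$, and $|\Psi_s|-2$ otherwise. (3) If $l=r\ne s$: $|\Psi_s^2(R)|=1$ if $R\in\mathcal{S}_{rs}(P)$, $|\Psi_s|$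 if $R=P$, and $0$ otherwise; $|\Psi_s^3(R)|=|\Psi_s|-1$ if $R\in\mathcal{S}_{rs}(P)$, $0$ if $R=P$, and $|\Psi_s|$ otherwise. (4) If $l\ne r=s$: $|\Psi_s^2(R)|=2$ if $R\in\mathcal{S}_{rs}(P)$ and $1$ otherwise; $|\Psi_s^3(R)|=|\Psi_s|-2$ if $R\in\mathcal{S}_{rs}(P)$ and $|\Psi_s|-1$ otherwise.
   Context: Points are the $1$-dimensional subspaces of $\mathbb{F}_2^v$, $\Psi$ is the set of all points. For two distinct points $P,R$ of $\mathbb{F}_2^v$, $P+R$ denotes the third point of the $2$-dimensional subspace $\langle P,R\rangle$ (i.e. spanned by the sum of the nonzero vectors of $P$ and $R$). A design over $\mathbb{F}_2$ with parameters $2$-$(v,k,\lambda_2)$ is a finite set $\mathcal{B}$ of $k$-dimensional subspaces (blocks) of $\mathbb{F}_2^v$ such that every $2$-dimensional subspace is contained in exactly $\lambda_2$ blocks. An automorphism group is a subgroup $G\le GL_v(2)$ with $\Phi\mathcal{B}=\mathcal{B}$ for all $\Phi\in G$. The $G$-orbits $\Psi_1,\dots,\Psi_m$ on $\Psi$ and $\mathcal{B}_1,\dots,\mathcal{B}_n$ on $\mathcal{B}$ form a tactical decomposition: there are integers $\rho_{ij}$, $\kappa_{ij}$ with each point of $\Psi_i$ in exactly $\rho_{ij}$ blocks of $\mathcal{B}_j$ and each block of $\mathcal{B}_j$ containing exactly $\kappa_{ij}$ points of $\Psi_i$. *)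

(* Defs.v *)
From HB Require Import structures.
From mathcomp Require Import all_boot all_order all_fingroup all_algebra.

Set Implicit Arguments.
Unset Strict Implicit.
Unset Printing Implicit Defensive.

Import GRing.Theory.
Local Open Scope ring_scope.

Section FiniteVspace.
Import VectorInternalTheory.
Variables (K : finFieldType) (vT : vectType K).
HB.instance Definition _ := [Countable of {vspace vT} by <:].
HB.instance Definition _ := [Finite of {vspace vT} by <:].
End FiniteVspace.

(* The group type {'GL_v(2)} of the library consists of matrices of size
   v.-1.+1, so the space it acts on is taken with that dimension, which is v as
   soon as 0 < v. *)
Notation F2 v := ('rV['F_2]_(v.-1.+1)).
Notation subspace v := {vspace F2 v}.

Section SubspaceAction.
Variable v : nat.
Implicit Types (U : subspace v) (g : {'GL_v(2)}).

(* Matrices act on row vectors from the right, so that this is an action in the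
   sense of the library. *)
Definition subspace_act U g : subspace v :=
  (linfun (mulmxr (GLval g) : F2 v -> F2 v) @: U)%VS.

Lemma subspace_act1 U : subspace_act U 1%g = U.
Proof.
rewrite /subspace_act (_ : linfun _ = \1%VF) ?lim1g //.
by apply/lfunP=> u; rewrite lfunE /= id_lfunE -[RHS]mulmx1.
Qed.

Lemma subspace_actM U g h :
  subspace_act U (g * h)%g = subspace_act (subspace_act U g) h.
Proof.
rewrite /subspace_act -limg_comp; congr (_ @: U)%VS.
by apply/lfunP=> u; rewrite comp_lfunE !lfunE /= -mulmxA.
Qed.

Canonical subspace_action := TotalAction subspace_act1 subspace_actM.

End SubspaceAction.

Definition points v : {set subspace v} := [set U | \dim U == 1%N].

(* On a 1-dimensional subspace over 'F_2, [vpick] returns its unique nonzero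
   vector. Meaningful for distinct points only: [point_add P P = 0%VS]. *)
Definition point_add v (P R : subspace v) : subspace v :=
  <[vpick P + vpick R]>%VS.

Definition is_design2 v (k lam : nat) (B : {set subspace v}) : Prop :=
  (forall U, U \in B -> \dim U = k) /\
  (forall T : subspace v, \dim T = 2%N -> #|[set U in B | (T <= U)%VS]| = lam).

Definition is_automorphism_group v (B : {set subspace v})
    (G : {group {'GL_v(2)}}) : Prop :=
  forall g, g \in G -> [set subspace_act U g | U in B] = B.

(* [C] lists the G-orbits on [X], each exactly once. *)
Definition orbit_decomposition v (G : {group {'GL_v(2)}})
    (X : {set subspace v}) (m : nat) (C : 'I_m -> {set subspace v}) : Prop :=
  injective C /\
  [set C i | i : 'I_m] = [set orbit (@subspace_action v) G U | U in X].

Definition span_dim_set v (O : {set subspace v}) (P R : subspace v) (i : nat) :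
  {set subspace v} := [set Q in O | \dim (P + R + Q)%VS == i].

Definition third_point_set v (Or Os : {set subspace v}) (P : subspace v) :
  {set subspace v} := [set R' in Or :\ P | point_add P R' \in Os].

(* Main.v *)
Require Import Defs.
From mathcomp Require Import all_boot all_order all_fingroup all_algebra.
From mathcomp Require Import zify.

Set Implicit Arguments.
Unset Strict Implicit.
Unset Printing Implicit Defensive.

Import GRing.Theory.
Local Open Scope ring_scope.

(** Let U be the span of P and R. Adding a point Q to U raises the dimension by
one unless Q lies in U, so the sets Psi_s^i(R) with i = dim U and i = dim U + 1
split Psi_s into its points inside and outside U, and the third one is empty.
Over 'F_2 the points of U are P alone if R = P, and P, R and P + R otherwise;
which of them lie in Psi_s is decided by the indices l, r, s and by S_rs(P). *)

Lemma card_setI_sum (T : finType) (A B : {set T}) :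
  #|A :&: B| = (\sum_(x in B) (x \in A))%N.
Proof.
rewrite -sum1_card big_mkcond [RHS]big_mkcond; apply: eq_bigr => x _.
by rewrite inE; do 2 case: (x \in _).
Qed.

Section LineSums.

Variables (K : fieldType) (vT : vectType K).
Implicit Types (u : vT) (U : {vspace vT}).

Lemma dim_addv_line U u : \dim (U + <[u]>) = ((u \notin U) + \dim U)%N.
Proof.
have spanU := span_basis (vbasisP U); have [Uu | U'u] := boolP (u \in U).
  by rewrite (addv_idPl _) // -memvE.
have : free (u :: vbasis U).
  by rewrite free_cons spanU U'u (basis_free (vbasisP U)).
by move/eqP; rewrite span_cons spanU size_tuple addvC.
Qed.

Lemma vline_vpick U : \dim U = 1%N -> <[vpick U]>%VS = U.
Proof.
move=> dimU; apply/eqP; rewrite eqEdim -memvE memv_pick dim_vline vpick0.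
by rewrite -dimv_eq0 dimU.
Qed.

End LineSums.

Section LinesOverF2.

Variable vT : vectType 'F_2.
Implicit Types (u w x : vT) (U : {vspace vT}).

Lemma mem_addv_line_F2 U w x :
  (x \in U + <[w]>)%VS = (x \in U) || (x - w \in U).
Proof.
apply/memv_addP/orP=> [[u Uu [_ /vlineP[a ->] ->]] | [Ux | Uxw]].
- have [-> | ->] : a = 0 \/ a = 1.
    by case: a => [[|[|a]] lta] //; [left | right]; apply: val_inj.
  + by rewrite scale0r addr0; left.
  + by rewrite scale1r addrK; right.
- by exists x => //; exists 0; rewrite ?mem0v ?addr0.
- by exists (x - w) => //; exists w; rewrite ?memv_line ?subrK.
Qed.

Lemma mem_line_F2 w x : (x \in <[w]>%VS) = (x \in [:: 0; w]).
Proof. by rewrite -[<[w]>%VS]add0v mem_addv_line_F2 !memv0 subr_eq0 !inE. Qed.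

Lemma mem_addv_lines_F2 u w x :
  (x \in <[u]> + <[w]>)%VS = (x \in [:: 0; u; w; u + w]).
Proof.
by rewrite mem_addv_line_F2 !mem_line_F2 !inE subr_eq0 subr_eq -orbA.
Qed.

Lemma oppv_F2 u : - u = u.
Proof.
by rewrite -scaleN1r (_ : -1 = 1 :> 'F_2) ?scale1r //; apply: val_inj.
Qed.

Lemma vlineK_F2 : cancel (fun u => <[u]>%VS) (@vpick _ vT).
Proof.
move=> u; have := memv_pick <[u]>%VS; rewrite mem_line_F2 !inE vpick0.
case/orP=> [line0 | /eqP //]; move: (line0).
rewrite -dimv_eq0 dim_vline eqb0 negbK => /eqP u0.
by rewrite {2}u0; apply/eqP; rewrite vpick0.
Qed.

Lemma vline_inj_F2 : injective (fun u => <[u]>%VS).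
Proof. exact: can_inj vlineK_F2. Qed.

End LinesOverF2.

Section PointsOfSubspaces.

Variable v : nat.
Implicit Types U P Q R : subspace v.

Lemma pointP P :
  reflect (exists2 p : F2 v, p != 0 & P = <[p]>%VS) (P \in points v).
Proof.
rewrite inE; apply: (iffP eqP) => [dimP | [p p_neq0 ->]].
  by exists (vpick P); rewrite ?vline_vpick // vpick0 -dimv_eq0 dimP.
by rewrite dim_vline p_neq0.
Qed.

Lemma dim_addv_point U Q :
  Q \in points v -> \dim (U + Q) = (~~ (Q <= U)%VS + \dim U)%N.
Proof. by case/pointP=> q _ ->; rewrite dim_addv_line memvE. Qed.

Lemma sub_points P Q :
  P \in points v -> Q \in points v -> (P <= Q)%VS = (P == Q).
Proof. by rewrite !inE eqEdim => /eqP-> /eqP->; rewrite andbT. Qed.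

Lemma dim_addv_points P R :
  P \in points v -> R \in points v -> \dim (P + R) = (P != R).+1.
Proof.
move=> ptP ptR; rewrite dim_addv_point // sub_points // eq_sym.
by move: ptP; rewrite inE => /eqP->; rewrite addn1.
Qed.

Definition points_in U : {set subspace v} := [set Q in points v | (Q <= U)%VS].

Lemma points_in_point P : P \in points v -> points_in P = [set P].
Proof.
move=> ptP; apply/setP=> Q; rewrite [LHS]in_set [RHS]in_set1.
have [-> | neqQP] := eqVneq Q P; first by rewrite ptP subvv.
by apply: contraNF neqQP => /andP[ptQ]; rewrite sub_points.
Qed.

Lemma point_add_vline (p r : F2 v) : point_add <[p]>%VS <[r]>%VS = <[p + r]>%VS.
Proof. by rewrite /point_add !vlineK_F2. Qed.

Lemma point_add_point P R : P \in points v -> R \in points v -> P != R ->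
  point_add P R \in points v.
Proof.
move=> /pointP[p _ ->] /pointP[r _ ->] neqPR; rewrite point_add_vline.
apply/pointP; exists (p + r) => //; rewrite addr_eq0 oppv_F2.
by apply: contraNneq neqPR => ->.
Qed.

Lemma point_add_notin P R : P \in points v -> R \in points v ->
  point_add P R \notin [set P; R].
Proof.
case/pointP=> p p_neq0 -> /pointP[r r_neq0 ->].
rewrite point_add_vline !inE !(inj_eq (@vline_inj_F2 _)).
rewrite negb_or; apply/andP; split; rewrite -subr_eq0.
- by rewrite addrAC subrr add0r.
- by rewrite addrK.
Qed.

Lemma sub_addv_points P R Q :
    P \in points v -> R \in points v -> Q \in points v ->
  (Q <= P + R)%VS = (Q \in [set P; R; point_add P R]).
Proof.
case/pointP=> p _ -> /pointP[r _ ->] /pointP[q q_neq0 ->].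
rewrite point_add_vline -memvE mem_addv_lines_F2 !inE (negPf q_neq0) /=.
by rewrite !(inj_eq (@vline_inj_F2 _)) orbA.
Qed.

Lemma points_in_line P R : P \in points v -> R \in points v -> P != R ->
  points_in (P + R) = [set P; R; point_add P R].
Proof.
move=> ptP ptR neqPR.
have line_points : [set P; R; point_add P R] \subset points v.
  by rewrite !subUset !sub1set ptP ptR point_add_point.
apply/setP=> Q; rewrite [LHS]in_set.
apply/andP/idP=> [[ptQ] | lineQ]; first by rewrite sub_addv_points.
by have ptQ := subsetP line_points Q lineQ; rewrite sub_addv_points.
Qed.

Section SpanDimSet.

Variable O : {set subspace v}.
Hypothesis O_points : O \subset points v.

Lemma span_dim_setE P R i :
  span_dim_set O P R i =
    if i == \dim (P + R) then O :&: points_in (P + R)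
    else if i == (\dim (P + R)).+1 then O :\: points_in (P + R) else set0.
Proof.
apply/setP=> Q; rewrite !(fun_if (fun A : {set _} => Q \in A)).
rewrite in_setI in_setD in_set0 in_set.
have [OQ | O'Q] := boolP (Q \in O); last by rewrite !andbF !if_same.
have ptQ := subsetP O_points Q OQ.
rewrite (_ : (Q \in points_in _) = (Q <= P + R)%VS); last by rewrite in_set ptQ.
rewrite dim_addv_point // eq_sym.
by case: (Q <= P + R)%VS; do 2?case: eqP; lia.
Qed.

Lemma card_span_dim_set_same P : P \in points v ->
  [/\ #|span_dim_set O P P 1| = (P \in O),
      (#|span_dim_set O P P 1| + #|span_dim_set O P P 2|)%N = #|O|
    & #|span_dim_set O P P 3| = 0%N].
Proof.
move=> ptP; rewrite !span_dim_setE dim_addv_points // eqxx /= addvv cardsID.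
by rewrite points_in_point // card_setI_sum big_set1 cards0.
Qed.

Lemma card_span_dim_set_distinct P R :
    P \in points v -> R \in points v -> P != R ->
  [/\ #|span_dim_set O P R 1| = 0%N,
      #|span_dim_set O P R 2| =
        ((P \in O) + (R \in O) + (point_add P R \in O))%N
    & (#|span_dim_set O P R 2| + #|span_dim_set O P R 3|)%N = #|O|].
Proof.
move=> ptP ptR neqPR.
rewrite !span_dim_setE dim_addv_points // neqPR /= cardsID cards0.
rewrite points_in_line // card_setI_sum setUC big_setU1 ?point_add_notin //=.
by rewrite big_setU1 ?inE //= big_set1 addnC.
Qed.

End SpanDimSet.

End PointsOfSubspaces.

Section OrbitDecomposition.

Variables (v : nat) (G : {group {'GL_v(2)}}) (X : {set subspace v}).
Variables (m : nat) (C : 'I_m -> {set subspace v}).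
Hypothesis C_orbits : orbit_decomposition G X C.
Implicit Types (U : subspace v) (i j : 'I_m).

Lemma orbit_decomposition_orbit i :
  exists2 U, U \in X & C i = orbit (@subspace_action v) G U.
Proof. by apply/imsetP; rewrite -C_orbits.2 imset_f. Qed.

Lemma mem_orbit_decomposition i j U : U \in C i -> (U \in C j) = (i == j).
Proof.
move=> Ci_U; apply/idP/eqP=> [Cj_U | <- //]; apply: C_orbits.1.
have [V _ Ci] := orbit_decomposition_orbit i.
have [W _ Cj] := orbit_decomposition_orbit j.
by move: Ci_U Cj_U; rewrite Ci Cj => /orbit_eqP<- /orbit_eqP<-.
Qed.

Lemma orbit_decomposition_sub i :
  [acts G, on X | @subspace_action v] -> C i \subset X.
Proof.
move=> actsGX; have [U XU ->] := orbit_decomposition_orbit i.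
by rewrite acts_sub_orbit.
Qed.

End OrbitDecomposition.

Lemma dim_subspace_act v (U : subspace v) (g : {'GL_v(2)}) :
  \dim (subspace_act U g) = \dim U.
Proof.
apply: limg_dim_eq; rewrite (eqP (_ : lker _ == 0%VS)) ?capv0 //.
apply/lker0P=> u w; rewrite !lfunE.
exact: (can_inj (mulmxK (GL_unitmx g))).
Qed.

Lemma acts_points v (G : {group {'GL_v(2)}}) :
  [acts G, on points v | @subspace_action v].
Proof.
by apply/actsP=> g _ U; rewrite !in_set /= dim_subspace_act.
Qed.

Theorem mainTheorem3 (v k lam : nat) (hv : (0 < v)%N)
  (B : {set subspace v}) (hB : is_design2 k lam B)
  (G : {group {'GL_v(2)}}) (hG : is_automorphism_group B G)
  (m n : nat) (Psi : 'I_m -> {set subspace v}) (Bl : 'I_n -> {set subspace v})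
  (hPsi : orbit_decomposition G (points v) Psi)
  (hBl : orbit_decomposition G B Bl)
  (l r s : 'I_m) (P R : subspace v) (hP : P \in Psi l) (hR : R \in Psi r) :
  let S := third_point_set (Psi r) (Psi s) P in
  let Psi1 := span_dim_set (Psi s) P R 1 in
  let Psi2 := span_dim_set (Psi s) P R 2 in
  let Psi3 := span_dim_set (Psi s) P R 3 in
  let card (X : {set subspace v}) : int := #|X|%:Z in
  card Psi1 = (if [&& l == r, r == s & R == P] then 1 else 0) /\
  [/\ (l <> r -> r <> s -> s <> l ->
        card Psi2 = (if R \in S then 1 else 0) /\
        card Psi3 = (if R \in S then card (Psi s) - 1 else card (Psi s))),
      (l = r -> r = s ->
        card Psi2 = (if R \in S then 3
                     else if R == P then card (Psi s) - 1 else 2) /\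
        card Psi3 = (if R \in S then card (Psi s) - 3
                     else if R == P then 0 else card (Psi s) - 2)),
      (l = r -> r <> s ->
        card Psi2 = (if R \in S then 1
                     else if R == P then card (Psi s) else 0) /\
        card Psi3 = (if R \in S then card (Psi s) - 1
                     else if R == P then 0 else card (Psi s)))
    & (l <> r -> r = s ->
        card Psi2 = (if R \in S then 2 else 1) /\
        card Psi3 = (if R \in S then card (Psi s) - 2
                     else card (Psi s) - 1))].
Proof.
move=> S Psi1 Psi2 Psi3 card.
have Psi_points i := orbit_decomposition_sub hPsi i (acts_points G).
have [ptP ptR] := (subsetP (Psi_points l) _ hP, subsetP (Psi_points r) _ hR).
have memP i := mem_orbit_decomposition hPsi i hP.
have memR i := mem_orbit_decomposition hPsi i hR.
have memS : (R \in S) = (R != P) && (point_add P R \in Psi s).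
  by rewrite !inE hR andbT.
rewrite memS {S memS} /card /Psi1 /Psi2 /Psi3 {card Psi1 Psi2 Psi3}.
have [eqRP | neqRP] := eqVneq R P.
  have eq_lr : l = r by apply/eqP; rewrite -memP -eqRP.
  have [] := card_span_dim_set_same (Psi_points s) ptP.
  rewrite eqRP memP -eq_lr eqxx /= => -> <- ->.
  split; [by case: (l == s) | split=> // _].
  - by move->; rewrite eqxx; lia.
  - by move/eqP/negPf->; lia.
have [|-> card2 <-] := card_span_dim_set_distinct (Psi_points s) ptP ptR.
  by rewrite eq_sym.
rewrite card2 memP memR !andbF {card2 memP memR neqRP} /=; split=> //.
split=> [/eqP/negPf _ /eqP/negPf-> /eqP/negPf | -> -> | -> /eqP/negPf->
        | /eqP/negPf + <-]; rewrite ?[s == l]eq_sym ?eqxx.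
- by move->; case: (_ \in Psi s) => /=; lia.
- by case: (_ \in Psi s) => /=; lia.
- by case: (_ \in Psi s) => /=; lia.
- by move->; case: (_ \in Psi r) => /=; lia.
Qed.
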